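(* Let $\kappa$ be an infinite cardinal with $\kappa = \kappa^{\omega} \le 2^{\mathfrak{c}}$. Then there is a locally countable SAU space of cardinality $\kappa$.
   Context: $\mathfrak{c}=2^{\omega}$ denotes the cardinality of the continuum. A topological space is SAU (strongly anti-Urysohn) if it is Hausdorff, has at least two non-isolated points, and any two infinite closed subsets of it have non-empty intersection. A space is locally countable if every point has a countable neighborhood. *)

(* Defs.v *)
From mathcomp Require Import all_boot all_order.
From mathcomp Require Import boolp classical_sets functions cardinality topology.

Set Implicit Arguments.
Unset Strict Implicit.
Unset Printing Implicit Defensive.

Local Open Scope classical_set_scope.

(* A cardinal is represented by a type having it as cardinality; the exponential
   of cardinals is then the function type. *)
Definition continuum : Type := nat -> bool.

Definition strongly_anti_Urysohn (X : topologicalType) : Prop :=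
  [/\ hausdorff_space X,
      exists x y : X,
        [/\ x <> y, ~ isolated [set: X] x & ~ isolated [set: X] y]
    & forall A B : set X,
        closed A -> infinite_set A -> closed B -> infinite_set B ->
        A `&` B !=set0].

Definition locally_countable (X : topologicalType) : Prop :=
  forall x : X, exists2 U : set X, nbhs x U & countable U.

(* Main.v *)
(* The space lives on [K] itself.  By [kappa^omega = kappa] the points of [K]
   enumerate all pairs (A, B) of countably infinite subsets of [K].  A point
   [x] with pair (A, B) is made a limit of a free ultrafilter on A and of one
   on B: a set is open when it belongs to both ultrafilters of each of its
   points.  Hence A and B have a common limit, and infinite closed sets meet;
   closing a point under the maps x |-> A, B gives a countable open set.

   For the Hausdorff property one needs that any countably many of these
   ultrafilters contain pairwise disjoint sets: inside a countable open set
   these disjoint sets form a forest, and two trees of it separate two points.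
   So the ultrafilters are chosen as copies of 2^c many weak P-points of a
   countable set, pairwise Rudin-Keisler inequivalent.  The weak P-points are
   obtained by Kunen's construction of c-OK points: a recursion of length c
   along an independent linked matrix, each stage spending finitely many of
   its c rows.  Since a Rudin-Keisler class has at most c elements, Koenig's
   theorem yields 2^c = (2^c)^c inequivalent ones. *)

Require Import Defs.
From HB Require Import structures.
From Stdlib Require Import Wellfounded.
From mathcomp Require Import finmap wochoice.
From mathcomp Require Import all_boot all_order.
From mathcomp Require Import boolp classical_sets functions cardinality topology.

Set Implicit Arguments.
Unset Strict Implicit.
Unset Printing Implicit Defensive.

Local Open Scope classical_set_scope.
Local Open Scope card_scope.

(** * Well-orders *)

Lemma wf_linear_order (T : Type) : exists lt : T -> T -> Prop,
  [/\ well_founded lt, (forall x y z, lt x y -> lt y z -> lt x z) &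
      forall x y, [\/ lt x y, x = y | lt y x]].
Proof.
have [R wo] := well_ordering_principle {classic T}.
have woT : wo_chain R predT by move=> A _; exact: wo.
have tot : total R.
  by move=> x y; exact: (wo_chainW woT).
have anti : antisymmetric R.
  by move=> x y; exact: (wo_chain_antisymmetric woT).
have minR (A : set T) : A !=set0 -> exists2 x, A x & forall y, A y -> R x y.
  move=> [x Ax]; have [|z [[Az zmin] _]] := wo (fun y => `[< A y >]).
    by exists x; exact/asboolP.
  by exists z => [|y Ay]; [exact/asboolP|apply: zmin; exact/asboolP].
have trR x y z : R x y -> R y z -> R x z.
  move=> xy yz.
  have [|w ws wmin] := minR [set x; y; z]; first by exists x; left; left.
  have [wx wy wz] : [/\ R w x, R w y & R w z].
    by split; apply: wmin; [left; left|left; right|right].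
  case: ws => [[|]|] /= wE; rewrite wE in wx wy wz => //.
  - by rewrite (anti x y) ?yz // xy wx.
  - by rewrite -(anti y z) ?xy // yz wy.
exists (fun x y => R x y /\ x <> y); split.
- move=> x; apply: contrapT => nx.
  have [y /= ny ymin] :=
    minR [set y | ~ Acc (fun x y => R x y /\ x <> y) y]
         (ex_intro (fun y => ~ Acc _ y) x nx).
  apply: ny; constructor => z [zy zny]; apply: contrapT => nz.
  by apply: zny; apply: anti; rewrite zy ymin.
- move=> x y z [xy nxy] [yz nyz]; split; first exact: trR yz.
  by move=> xz; subst z; apply: nxy; apply: anti; rewrite xy yz.
- move=> x y; have [->|nxy] := pselect (x = y); first by constructor 2.
  have /orP[xy|yx] := tot x y; first by constructor 1.
  by constructor 3; split => // yx'; apply: nxy.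
Qed.

(* The well-order on [W] has the order type of the cardinal of [T]. *)
Lemma initial_well_order (T : Type) :
  exists (W : Type) (lt : W -> W -> Prop) (e : W -> T),
  [/\ well_founded lt, (forall x y z, lt x y -> lt y z -> lt x z),
      (forall x y, [\/ lt x y, x = y | lt y x]),
      (forall t, exists w, e w = t) &
      forall w (g : W -> T), exists t, forall v, lt v w -> g v <> t].
Proof.
have [lt [wf tr tot]] := wf_linear_order T.
pose big w := exists g : T -> T, forall t, exists2 v, lt v w & g v = t.
(* The least point whose initial segment maps onto [T] cuts off the order wanted; without one, the
   order on all of [T] serves. *)
have [[w0 [[g gsurj] wmin]]|nbig] :=
    pselect (exists w, big w /\ forall v, lt v w -> ~ big v).
  exists {v | lt v w0}, (fun x y => lt (sval x) (sval y)), (fun v => g (sval v)).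
  split.
  - exact: (@wf_inverse_image _ _ lt sval).
  - by move=> x y z; exact: tr.
  - move=> x y; case: (tot (sval x) (sval y)) => h.
    + by constructor 1.
    + by constructor 2; case: x y h => x px [y py] /= xy; exact: eq_exist.
    + by constructor 3.
  - by move=> t; have [v vw <-] := gsurj t; exists (exist _ v vw).
  - move=> [w ww0] h; apply: contrapT => nt; apply: (wmin w ww0).
    exists (fun v => if pselect (lt v w0) is left p then h (exist _ v p) else v).
    move=> t; apply: contrapT => ntv; apply: nt; exists t => -[v vw0] /= vw hv.
    apply: ntv; exists v => //; case: pselect => // p.
    by rewrite (_ : p = vw0) //; exact: Prop_irrelevance.
exists T, lt, id; split => //; first by move=> t; exists t.
move=> w; elim/(well_founded_ind wf) : w => w IH g.
apply: contrapT => nt; apply: nbig; exists w; split.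
  exists g => t; apply: contrapT => ntv; apply: nt; exists t => v vw gvt.
  by apply: ntv; exists v.
move=> v vw [h hsurj]; have [t tn] := IH v vw h.
by have [u uv /(tn u uv)] := hsurj t.
Qed.

(** Recursion with choice. As [P] depends on [g] only below [w], the values already built may be
    completed by a default element of [A]. *)
Lemma wf_dependent_choice (W A : Type) (lt : W -> W -> Prop)
    (P : W -> (W -> A) -> A -> Prop) :
  A -> well_founded lt ->
  (forall w g h a, (forall v, lt v w -> g v = h v) -> P w g a -> P w h a) ->
  (forall w g, exists a, P w g a) ->
  exists g, forall w, P w g (g w).
Proof.
move=> a0 wf Pext Pex.
pose tot w (rec : forall v, lt v w -> A) v :=
  if pselect (lt v w) is left p then rec v p else a0.
pose step w rec := sval (cid (Pex w (tot w rec))).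
pose g := Fix wf (fun=> A) step; exists g => w.
have gE : g w = step w (fun v _ => g v).
  apply: Fix_eq => x f h fh; congr step.
  by apply: functional_extensionality_dep => y; apply: funext.
rewrite gE /step; case: cid => a /= Pa.
by apply: Pext Pa => v vw; rewrite /tot; case: pselect.
Qed.

(** * A linked matrix *)

Definition restr (k : nat) (z : continuum) : k.-tuple bool :=
  [tuple z i | i < k].

(* A real acts on a site of level [k] through its first [k] digits: the first
   component marks some strings of length [k], the second one assigns to every
   string a set of strings. *)
Definition site : Type :=
  {k : nat & ({set k.-tuple bool} *
              {ffun k.-tuple bool -> {set k.-tuple bool}})%type}.

Definition level (x : site) : nat := tag x.

Definition marked (x : site) (z : continuum) : bool :=
  restr (level x) z \in (tagged x).1.

Definition cell (x : site) (r : continuum) : {set (level x).-tuple bool} :=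
  (tagged x).2 (restr (level x) r).

(** The cardinality bound makes rows usable: for a pair [(r, Z)], a site of the box lies in
    [linked u r z] for all [z] in [Z] once it lies in [u m] for each [m < size Z]. *)
Definition box (q : seq (continuum * seq continuum)) : set site :=
  [set x | forall rZ, rZ \in q ->
    (forall z, z \in rZ.2 -> restr (level x) z \in cell x rZ.1) /\
    (#|cell x rZ.1| <= size rZ.2)%N].

(* Kunen's linked sets: for [n.+1] distinct reals [z] their intersection lies in
   [u n], up to finitely many levels. *)
Definition linked (u : nat -> set site) (r z : continuum) : set site :=
  [set x | restr (level x) z \in cell x r /\
           forall m, (m < #|cell x r|)%N -> u m x].

Lemma restr_eq k (x y : continuum) :
  restr k x = restr k y <-> forall i, (i < k)%N -> x i = y i.
Proof.
split=> [/(congr1 (fun t => tnth t)) h i ik|h].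
  by have := congr1 (fun t => t (Ordinal ik)) h; rewrite !tnth_mktuple.
by apply: eq_from_tnth => i; rewrite !tnth_mktuple h.
Qed.

Lemma restr_separates (X : seq continuum) :
  exists k0, forall k, (k0 <= k)%N -> {in X &, injective (restr k)}.
Proof.
elim: X => [|x X [k0 IH]]; first by exists 0%N.
have [k1 h1] : exists k1, forall k, (k1 <= k)%N -> forall y, y \in X ->
    restr k x = restr k y -> x = y.
  elim: X {IH} => [|y X [k1 h1]]; first by exists 0%N.
  have [->|yx] := pselect (y = x).
    by exists k1 => k k1k z; rewrite inE => /orP[/eqP ->//|zX]; exact: h1.
  have [i xyi] : exists i, x i <> y i.
    by apply: contrapT => n; apply: yx; apply/esym/funext => i;
       apply: contrapT => ni; apply: n; exists i.
  exists (maxn k1 i.+1) => k; rewrite geq_max => /andP[k1k ik] z.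
  rewrite inE => /orP[/eqP ->|zX]; last exact: h1.
  by move/restr_eq => /(_ i ik)/xyi.
exists (maxn k0 k1) => k; rewrite geq_max => /andP[k0k k1k] y z.
rewrite !inE => /orP[/eqP ->|yX] /orP[/eqP ->|zX] //.
- exact: h1.
- by move=> /esym/(h1 _ k1k _ yX).
- exact: IH.
Qed.

Lemma box_cat q q' x : box (q ++ q') x <-> box q x /\ box q' x.
Proof.
split=> [h|[h h'] rZ].
  by split=> rZ rZq; apply: h; rewrite mem_cat rZq ?orbT.
by rewrite mem_cat => /orP[/h|/h'].
Qed.

Lemma unzip1_uniq_fun (T : eqType) (U : eqType) (q : seq (T * U)) r Y Y' :
  uniq (unzip1 q) -> (r, Y) \in q -> (r, Y') \in q -> Y = Y'.
Proof.
elim: q => [|[s A] q IH] //= /andP[sq uq]; rewrite !inE.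
have notin B : (s, B) \in q -> False by move=> /(map_f fst); apply/negP.
move=> /orP[/eqP[rs ->]|rY] /orP[/eqP[rs' ->]|rY'] //; last exact: IH.
  by case: (notin Y'); rewrite -rs.
by case: (notin Y); rewrite -rs'.
Qed.

(** At a high level the finitely many reals involved have distinct restrictions, so marks and cells
    can be prescribed independently. *)
Lemma box_independent (f : continuum -> bool) k0 (Z : seq continuum) q :
  uniq (unzip1 q) ->
  exists x, [/\ (k0 <= level x)%N, forall z, z \in Z -> marked x z = f z
              & box q x].
Proof.
move=> uq.
have [k1 h1] := restr_separates (Z ++ unzip1 q); pose k := maxn k0 k1.
have kinj : {in Z ++ unzip1 q &, injective (restr k)}.
  by apply: h1; rewrite leq_maxr.
pose phi : {set k.-tuple bool} := [set t in [seq restr k z | z <- Z & f z]]%SET.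
pose psi : {ffun k.-tuple bool -> {set k.-tuple bool}} :=
  [ffun t => [set s | has (fun rZ => (restr k rZ.1 == t) &&
                             (s \in [seq restr k z | z <- rZ.2])) q]]%SET.
pose x : site := Tagged _ (phi, psi).
(* [psi] collects over all pairs of [q], but at the string of [r] only the pair of [r] itself
   contributes. *)
have cellE r (Y : seq continuum) : (r, Y) \in q ->
    cell x r = [set t in [seq restr k z | z <- Y]]%SET.
  move=> rYq; apply/setP => t; rewrite /cell /= ffunE !inE.
  apply/hasP/idP => [[[r' Y'] rYq' /= /andP[/eqP rr' tY']]|tY]; last first.
    by exists (r, Y) => //=; rewrite eqxx.
  have mem_r s (A : seq continuum) : (s, A) \in q -> s \in Z ++ unzip1 q.
    by move=> sAq; rewrite mem_cat (map_f fst sAq) orbT.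
  have rE : r' = r by apply: kinj rr'; [exact: mem_r rYq'|exact: mem_r rYq].
  suff -> : Y = Y' by [].
  by apply: (unzip1_uniq_fun uq rYq); rewrite -rE.
exists x; split.
- by rewrite /level /= leq_maxl.
- move=> z zZ; rewrite /marked /= inE; apply/mapP/idP => [[y]|fz].
    rewrite mem_filter => /andP[fy yZ] /kinj ->//.
      by rewrite mem_cat zZ.
    by rewrite mem_cat yZ.
  by exists z => //; rewrite mem_filter fz.
- move=> [r Y] rYq /=; rewrite (cellE _ _ rYq); split.
    by move=> z zY; rewrite inE; apply: map_f.
  by rewrite cardsE (leq_trans (card_size _)) // size_map.
Qed.

(** * Ultrafilters containing linked sets *)

Definition meets (l : seq (set site)) : set site :=
  [set x | forall A, A \in l -> A x].

Lemma meets_cat l l' x : meets (l ++ l') x <-> meets l x /\ meets l' x.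
Proof.
split=> [h|[h h'] A].
  by split=> A Al; apply: h; rewrite mem_cat Al ?orbT.
by rewrite mem_cat => /orP[/h|/h'].
Qed.

Lemma meets_cons A l x : meets (A :: l) x <-> A x /\ meets l x.
Proof.
split=> [h|[h h'] B]; last by rewrite inE => /orP[/eqP ->|/h'].
by split=> [|B Bl]; apply: h; rewrite inE ?eqxx // Bl orbT.
Qed.

(** The finite intersection property, kept independent of every row not yet used. *)
Definition free_base (B : set (set site)) (used : set continuum) : Prop :=
  forall l q, (forall A, A \in l -> B A) -> uniq (unzip1 q) ->
    (forall r, r \in unzip1 q -> ~ used r) -> exists x, meets l x /\ box q x.

(** The second alternative keeps the [u n] from all lying in a proper filter that extends [B]. *)
Definition settles (B : set (set site)) (u : nat -> set site) : Prop :=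
  ((forall n, B (u n)) /\ exists r, forall z, B (linked u r z)) \/
  exists l n, (forall A, A \in l -> B A) /\
    forall x, meets l x -> exists2 m, (m < n)%N & ~ u m x.

(** The levels will make the ultrafilter free; the marks will tell the ultrafilters of different [f]
    apart. *)
Definition coloring_base (f : continuum -> bool) : set (set site) :=
  [set A | exists k, A = [set x | (k <= level x)%N]] `|`
  [set A | exists z, A = [set x | marked x z = f z]].

Lemma free_coloring_base f : free_base (coloring_base f) set0.
Proof.
move=> l q lB uq _.
have [k [Z kZ]] : exists k (Z : seq continuum), forall x, (k <= level x)%N ->
    (forall z, z \in Z -> marked x z = f z) -> meets l x.
  elim: l lB => [|A l IH] lB; first by exists 0%N, [::].
  have [C Cl|k [Z kZ]] := IH; first by apply: lB; rewrite inE Cl orbT.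
  have [[k' ->]|[z ->]] := lB A (mem_head _ _).
    exists (maxn k k'), Z => x; rewrite geq_max => /andP[kx k'x] zx.
    by apply/meets_cons; split => //; exact: kZ.
  exists k, (z :: Z) => x kx zx; apply/meets_cons; split.
    by apply: zx; exact: mem_head.
  by apply: kZ => // z' z'Z; apply: zx; rewrite inE z'Z orbT.
have [x [kx Zx qx]] := box_independent f k Z uq.
by exists x; split => //; exact: kZ.
Qed.

Lemma meets_range_decomp (B : set (set site)) (u : nat -> set site) l :
  (forall A, A \in l -> (B `|` range u) A) ->
  exists l' n, (forall A, A \in l' -> B A) /\
    forall x, meets l' x -> (forall m, (m < n)%N -> u m x) -> meets l x.
Proof.
elim: l => [|A l IH] lB; first by exists [::], 0%N.
have [C Cl|l' [n [l'B l'n]]] := IH; first by apply: lB; rewrite inE Cl orbT.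
have [BA|[m _ umA]] := lB A (mem_head _ _).
  exists (A :: l'), n; split => [C|x /meets_cons[Ax l'x] un].
    by rewrite inE => /orP[/eqP ->|/l'B].
  by apply/meets_cons; split => //; exact: l'n.
exists l', (maxn n m.+1); split => // x l'x un; apply/meets_cons; split.
  by rewrite -umA; apply: un; rewrite leq_max ltnSn orbT.
by apply: l'n => // i ni; apply: un; rewrite leq_max ni.
Qed.

(** If all [u n] can be added, the fresh row [r] is spent on their linked sets. Otherwise some box
    is incompatible with finitely many [u n] over [B]; adding this box spends its finitely many rows
    and rules [u] out. *)
Lemma free_base_step B used u r : free_base B used -> ~ used r ->
  exists a : set (set site) * seq continuum,
    free_base (B `|` a.1) (used `|` [set` a.2]) /\ settles (B `|` a.1) u.
Proof.
move=> fB nr.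
have [fBu|nfBu] := pselect (free_base (B `|` range u) used).
  exists (range u `|` range (linked u r), [:: r]) => /=; split; last first.
    left; split; first by move=> n; right; left; exists n.
    by exists r => z; right; right; exists z.
  move=> l q lB uq qu.
  have [l' [Z [l'B l'Z]]] : exists l' (Z : seq continuum),
      (forall A, A \in l' -> (B `|` range u) A) /\ forall x, meets l' x ->
      (forall z, z \in Z -> linked u r z x) -> meets l x.
    elim: l lB => [|A l IH] lB; first by exists [::], [::].
    have [C Cl|l' [Z [l'B l'Z]]] := IH; first by apply: lB; rewrite inE Cl orbT.
    have [BuA|[z zA]] : (B `|` range u) A \/ exists z, linked u r z = A.
      have [BA|[uA|[z _ zA]]] := lB A (mem_head _ _); first by left; left.
        by left; right.
      by right; exists z.
    - exists (A :: l'), Z; split => [C|x /meets_cons[Ax l'x] Zx].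
        by rewrite inE => /orP[/eqP ->|/l'B].
      by apply/meets_cons; split => //; exact: l'Z.
    - exists l', (z :: Z); split => // x l'x Zx; apply/meets_cons; split.
        by rewrite -zA; apply: Zx; exact: mem_head.
      by apply: l'Z => // z' z'Z; apply: Zx; rewrite inE z'Z orbT.
  (* The linked sets occurring in [l] are realized by the condition [(r, Z)] on the fresh row. *)
  have [| | |x [/meets_cat[l'x ux] qx]] :=
      fBu (l' ++ [seq u m | m <- iota 0 (size Z)]) ((r, Z) :: q).
  - move=> A; rewrite mem_cat => /orP[/l'B//|/mapP[m _ ->]].
    by right; exists m.
  - rewrite /= uq andbT; apply/negP => rq.
    by apply: (qu r rq); right => /=; rewrite inE.
  - move=> s; rewrite /= inE => /orP[/eqP ->//|/qu nus us].
    by apply: nus; left.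
  exists x; split; last by move=> rZ rZq; apply: qx; rewrite inE rZq orbT.
  have [/= Zx sizex] := qx (r, Z) (mem_head _ _).
  apply: l'Z => // z zZ; split; first exact: Zx.
  move=> m mc; apply: ux; apply: map_f; rewrite mem_iota add0n.
  exact: leq_trans sizex.
have [l [q [lB uq qu lq]]] : exists l q,
    [/\ forall A, A \in l -> (B `|` range u) A, uniq (unzip1 q),
        forall r, r \in unzip1 q -> ~ used r &
        forall x, meets l x -> ~ box q x].
  apply: contrapT => n; apply: nfBu => l q lB uq qu; apply: contrapT => nx.
  by apply: n; exists l, q; split => // x lx qx; apply: nx; exists x.
exists ([set box q], unzip1 q) => /=; split.
  move=> l' q' l'B uq' q'u.
  (* The new member [box q] is traded for its conditions, whose rows are disjoint from those of
     [q']. *)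
  have [| | |x [l''x]] := fB [seq A <- l' | A != box q] (q ++ q').
  - by move=> A; rewrite mem_filter => /andP[/eqP nA /l'B[]].
  - rewrite /unzip1 map_cat cat_uniq uq uq' andbT /=; apply/hasPn => s sq'.
    by apply/negP => sq; apply: (q'u s sq'); right.
  - move=> s; rewrite /unzip1 map_cat mem_cat => /orP[/qu//|/q'u nus us].
    by apply: nus; left.
  move=> /box_cat[qx q'x]; exists x; split => // A Al'.
  have [->//|nA] := eqVneq A (box q).
  by apply: l''x; rewrite mem_filter nA.
right; have [l' [n [l'B l'n]]] := meets_range_decomp lB.
exists (box q :: l'), n; split.
  by move=> A; rewrite inE => /orP[/eqP ->|/l'B]; [right|left].
move=> x /meets_cons[qx l'x]; apply: contrapT => nm; apply: (lq x) => //.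
apply: l'n => // m mn; apply: contrapT => nu; apply: nm.
by exists m.
Qed.

(** * Bases growing along a well-order *)

Section Tower.
Variables (W : Type) (lt : W -> W -> Prop) (B0 : set (set site)).
Variable g : W -> set (set site) * seq continuum.
Hypothesis lt_trans : forall x y z, lt x y -> lt y z -> lt x z.
Hypothesis lt_total : forall x y, [\/ lt x y, x = y | lt y x].

Definition stage (D : set W) : set (set site) :=
  B0 `|` [set A | exists2 v, D v & (g v).1 A].

Definition spent (D : set W) : set continuum :=
  [set r | exists2 v, D v & r \in (g v).2].

Definition upto (w : W) : set W := [set v | lt v w \/ v = w].

Lemma stage_finite D (l : seq (set site)) : (forall A, A \in l -> stage D A) ->
  (forall A, A \in l -> B0 A) \/
  exists2 w, D w & forall A, A \in l -> stage (upto w) A.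
Proof.
elim: l => [|A l IH] lD; first by left.
have [C Cl|lB|[w Dw lw]] := IH; first by apply: lD; rewrite inE Cl orbT.
- have [BA|[v Dv gA]] := lD A (mem_head _ _).
    by left => C; rewrite inE => /orP[/eqP ->|/lB].
  right; exists v => // C; rewrite inE => /orP[/eqP ->|/lB BC]; last by left.
  by right; exists v => //; right.
- right; have [BA|[v Dv gA]] := lD A (mem_head _ _).
    exists w => // C; rewrite inE => /orP[/eqP ->|/lw//]; by left.
  have up y z : lt y z -> upto y `<=` upto z.
    by move=> yz x [xy|->]; left => //; exact: lt_trans yz.
  have grow y z X : upto y `<=` upto z -> stage (upto y) X -> stage (upto z) X.
    by move=> yz [?|[x xy gx]]; [left|right; exists x => //; exact: yz].
  have vA : stage (upto v) A by right; exists v => //; right.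
  have [vw|vw|wv] := lt_total v w.
  + exists w => // C; rewrite inE => /orP[/eqP ->|/lw//].
    exact: grow (up _ _ vw) vA.
  + by exists w => // C; rewrite inE => /orP[/eqP ->|/lw//]; rewrite -vw.
  + exists v => // C; rewrite inE => /orP[/eqP ->//|/lw].
    exact: grow (up _ _ wv).
Qed.

(** Freeness concerns finitely many members at a time. These lie in [B0] or in a single stage, where
    every row unspent over [D] is unspent too. *)
Lemma free_stage D : free_base B0 set0 ->
  (forall w, D w -> forall v, lt v w -> D v) ->
  (forall w, D w -> free_base (stage (upto w)) (spent (upto w))) ->
  free_base (stage D) (spent D).
Proof.
move=> fB0 Ddown fD l q lD uq qD.
have [lB|[w Dw lw]] := stage_finite lD; first by apply: fB0 => // r _ [].
apply: (fD w Dw) => // r rq [v vw rv]; apply: (qD r rq); exists v => //.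
by case: vw => [/(Ddown w Dw)|->].
Qed.

End Tower.

Lemma continuum_code (I : countType) : exists c : (I -> bool) -> continuum,
  injective c.
Proof.
exists (fun h n => if unpickle n is Some i then h i else false) => h h' hh'.
apply/funext => i; have := congr1 (fun c => c (pickle i)) hh'.
by rewrite pickleK.
Qed.

(** Every sequence of sets of sites is a task, settled at some stage of a recursion. A constant
    sequence decides its set, so the filter generated in the end is an ultrafilter. *)
Theorem linked_ultrafilter (f : continuum -> bool) :
  exists p : set_system site,
  [/\ ProperFilter p, forall A, p A \/ p (~` A),
      forall k, p [set x | (k <= level x)%N],
      forall z, p [set x | marked x z = f z] &
      forall u, (forall n, p (u n)) -> exists r, forall z, p (linked u r z)].
Proof.
pose T := nat -> set site.
have [W [lt [e [wf tr tot esurj small]]]] := initial_well_order T.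
have [code code_inj] : exists c : (nat -> T) -> continuum, injective c.
  have [c cinj] := continuum_code (nat * nat * site)%type.
  exists (fun r => c (fun i => `[< r i.1.1 i.1.2 i.2 >])) => r r' /cinj rr'.
  apply/funext => i; apply/funext => j; apply/funext => x.
  apply: propext; apply: asbool_eq_equiv.
  exact: (congr1 (fun h => h (i, j, x)) rr').
pose B0 := coloring_base f.
pose st (g : W -> _) w := stage B0 g [set v | lt v w].
pose sp (g : W -> set (set site) * seq continuum) w := spent g [set v | lt v w].
(* A stage has to succeed only if the base so far is free; that it always is follows by induction in
   [fw]. *)
pose P w g (a : set (set site) * seq continuum) :=
  free_base (st g w) (sp g w) ->
  free_base (st g w `|` a.1) (sp g w `|` [set` a.2]) /\
  settles (st g w `|` a.1) (e w).
have [||||g gP] := @wf_dependent_choice _ _ lt P.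
- exact: (set0, [::]).
- exact: wf.
- move=> w g h a gh; rewrite /P (_ : st g w = st h w); last first.
    rewrite /st /stage; congr (_ `|` _); apply/seteqP.
    by split => A [v /= vw gA]; exists v => //; rewrite ?gh // -gh.
  rewrite (_ : sp g w = sp h w) //; apply/seteqP.
  by split => r [v /= vw gr]; exists v => //; rewrite ?gh // -gh.
- move=> w g; have [fB|] := pselect (free_base (st g w) (sp g w)); last first.
    by move=> nfB; exists (set0, [::]).
  suff [r nr] : exists r, ~ sp g w r.
    by have [a ha] := free_base_step (e w) fB nr; exists a.
  (* Koenig's argument: a row is a sequence of tasks, and the coordinate [n] of
     the fresh one avoids the [n]-th rows spent at the earlier stages. *)
  pose t0 : T := fun=> set0.
  pose dec (c : continuum) : nat -> T := xget (fun=> t0) [set r | code r = c].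
  have decK : cancel code dec.
    move=> r; apply: code_inj.
    exact: (xgetPex _ (ex_intro (fun s => code s = code r) r erefl)).
  have /choice[r rP] : forall n, exists t, forall v, lt v w ->
      dec (nth (code (fun=> t0)) (g v).2 n) n <> t.
    by move=> n; exact: small.
  exists (code r) => -[v /= vw /(nthP (code (fun=> t0)))[n _ rn]].
  by apply: (rP n v vw); rewrite rn decK.
have stU w : stage B0 g (upto lt w) = st g w `|` (g w).1.
  apply/seteqP; split => A; rewrite /st /stage /upto /=.
    by move=> [?|[v [vw|->] gA]]; [left; left|left; right; exists v|right].
  move=> [[?|[v vw gA]]|gA]; first by left.
    by right; exists v; [left|].
  by right; exists w; [right|].
have spU w : spent g (upto lt w) = sp g w `|` [set` (g w).2].
  apply/seteqP; split => A; rewrite /sp /spent /upto /=.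
    by move=> [v [vw|->] gA]; [left; exists v|right].
  by move=> [[v vw gA]|gA]; [exists v; [left|]|exists w; [right|]].
have fB0 : free_base B0 set0  by exact: free_coloring_base.
have fw w : free_base (stage B0 g (upto lt w)) (spent g (upto lt w)).
  elim/(well_founded_ind wf) : w => w IH; rewrite stU spU.
  apply: (gP w _).1; apply: (free_stage tr tot fB0) => // v vw x xv.
  exact: tr vw.
have settled w : settles (stage B0 g (upto lt w)) (e w).
  rewrite stU; apply: (gP w _).2.
  by apply: (free_stage tr tot fB0) => // v vw x xv; exact: tr vw.
pose B := stage B0 g setT.
have fB : free_base B (spent g setT) by exact: (free_stage tr tot fB0).
have sub w : stage B0 g (upto lt w) `<=` B.
  by move=> A [|[v _ gA]]; [left|right; exists v].
pose p : set_system site := [set A | exists2 l, (forall C, C \in l -> B C) &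
  meets l `<=` A].
have pB A : B A -> p A.
  by move=> BA; exists [:: A] => [C|x /(_ A)]; rewrite inE ?eqxx;
     [move/eqP ->|exact].
have pF : ProperFilter p.
  apply: Build_ProperFilter_ex.
    move=> A [l lB lA]; have [//|//|x [/lA]] := fB l [::] lB; by exists x.
  split; first by exists [::].
  - move=> A A' [l lB lA] [l' lB' lA']; exists (l ++ l').
      by move=> C; rewrite mem_cat => /orP[/lB|/lB'].
    by move=> x /meets_cat[/lA ? /lA'].
  - by move=> A A' AA' [l lB lA]; exists l => //; exact: subset_trans AA'.
have pu u : ((forall n, p (u n)) /\ exists r, forall z, p (linked u r z)) \/
    exists n, p [set x | exists2 m, (m < n)%N & ~ u m x].
  have [w <-] := esurj u.
  case: (settled w) => [[h [r hr]]|[l [n [lB ln]]]].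
    left; split; first by move=> n; apply: pB; apply: sub.
    by exists r => z; apply: pB; apply: sub.
  by right; exists n, l => // C /lB; exact: sub.
exists p; split => //.
- move=> A; have [[h _]|[n pn]] := pu (fun=> A); first by left; exact: h 0%N.
  by right; apply: filterS pn => x [].
- by move=> k; apply: pB; left; left; exists k.
- by move=> z; apply: pB; left; right; exists z.
- move=> u hu; have [[_ //]|[n pn]] := pu u.
  have pn' : p [set x | forall m, (m < n)%N -> u m x].
    elim: n {pn} => [|n IH]; first by apply: filterS filterT => x _ m.
    apply: filterS (filterI IH (hu n)) => x [xn ux] m.
    by rewrite ltnS leq_eqVlt => /orP[/eqP ->|/xn].
  by have [x [[m mn nu] /(_ m mn)]] := filter_ex (filterI pn pn').
Qed.

(** * Inequivalent weak P-points *)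

Definition free_ultrafilter (T : Type) (p : set_system T) : Prop :=
  [/\ ProperFilter p, forall A, p A \/ p (~` A) &
      forall A, finite_set A -> ~ p A].

(* The families [q n] are not required to be filters, since they will be the
   traces of ultrafilters on partial copies of [site]. *)
Definition weakly_P (p : set_system site) : Prop :=
  forall q : nat -> set_system site,
    (forall n A B, q n A -> q n B -> q n (A `&` B)) ->
    (forall n A B, A `<=` B -> q n A -> q n B) ->
    (forall n A B, finite_set B -> q n A -> q n (A `\` B)) ->
    (forall n, exists2 U, p U & ~ q n U) ->
  exists2 V, p V & forall n, ~ q n V.

Lemma level_finite k : finite_set [set x | (level x < k)%N].
Proof.
have -> : [set x | (level x < k)%N] = \bigcup_(i in [set i | (i < k)%N])
    (fun v => Tagged _ v : site) @` [set: {set i.-tuple bool} *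
              {ffun i.-tuple bool -> {set i.-tuple bool}}].
  apply/seteqP; split => [[i v] /= ik|x [i /= ik [v _ <-]]] //.
  by exists i => //; exists v.
apply: bigcup_finite; first exact: finite_II.
by move=> i _; apply: finite_image; exact: finite_finset.
Qed.

Lemma continuum_uncountable : ~ countable [set: continuum].
Proof.
move=> /countable_injP[h hinj].
have {}hinj : injective h by move=> x y; apply: hinj; rewrite inE.
pose d : continuum := fun n => `[< exists2 z, h z = n & z n = false >].
have [dT|dF] := boolP (d (h d)).
  by have /asboolP[z /hinj -> zn] := dT; rewrite zn in dT.
by case/asboolP: (dF); exists d => //; exact/negbTE.
Qed.

(* If every [linked u r z] met some [q n], uncountably many [z] would share
   the same [n], while [n.+1] of these sets meet inside [u n]. *)
Lemma linked_weakly_P (p : set_system site) :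
  (forall u, (forall n, p (u n)) -> exists r, forall z, p (linked u r z)) ->
  weakly_P p.
Proof.
move=> plinked q qI qS qD qp.
have /choice[u pu] : forall n, exists U, p U /\ ~ q n U.
  by move=> n; have [U pU nqU] := qp n; exists U.
have [r pr] := plinked u (fun n => (pu n).1).
apply: contrapT => nV.
have /choice[N qN] : forall z, exists n, q n (linked u r z).
  move=> z; apply: contrapT => nz; apply: nV; exists (linked u r z) => // n qn.
  by apply: nz; exists n.
have [n infn] : exists n, infinite_set [set z | N z = n].
  apply: contrapT => nn; apply: continuum_uncountable.
  have -> : [set: continuum] = \bigcup_(n in [set: nat]) [set z | N z = n].
    by apply/seteqP; split => // z _; exists (N z).
  apply: bigcup_countable => // n _; apply: finite_set_countable.
  by apply: contrapT => nfin; apply: nn; exists n.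
have [Z ZN Zn] := infinite_set_fset n.+1 infn.
have [k kinj] := restr_separates (enum_fset Z).
have qT : q n setT.
  by have [z <-] := infinite_setN0 infn; exact: qS (qN z).
have qZ : q n [set x | forall z, z \in enum_fset Z -> linked u r z x].
  have : forall z, z \in enum_fset Z -> q n (linked u r z).
    by move=> z zZ; rewrite -(ZN z zZ); exact: qN.
  elim: (enum_fset Z) => [|z X IH] qX; first by apply: qS qT => x _ z.
  have {}IH := IH (fun y yX => qX y (@mem_behead _ (z :: X) y yX)).
  apply: qS (qI _ _ _ (qX z (mem_head _ _)) IH) => x [xz xX] y.
  by rewrite inE => /orP[/eqP ->|/xX].
apply: (pu n).2; apply: qS (qD _ _ _ (level_finite k) qZ) => x [xZ /negP].
rewrite -leqNgt => kx.
(* The more than [n] reals of [Z] have distinct strings at this level, all in the cell of [r]; so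
   the cell is large enough for [linked] to give [u n]. *)
have Zx : (size (enum_fset Z) <= #|cell x r|)%N.
  have uZ : uniq [seq restr (level x) z | z <- enum_fset Z].
    by rewrite map_inj_in_uniq ?fset_uniq //; exact: kinj.
  rewrite -(size_map (restr (level x))) -(card_uniqP uZ).
  apply: subset_leq_card; apply/fintype.subsetP => _ /mapP[z zZ ->].
  exact: (xZ z zZ).1.
have [z zZ] : exists z, z \in enum_fset Z.
  have : (0 < size (enum_fset Z))%N by exact: leq_trans Zn.
  by case: (enum_fset Z) => // z s _; exists z; exact: mem_head.
by apply: (xZ z zZ).2; exact: leq_trans Zn Zx.
Qed.

(** The image of [p] under [h]: [p = limit_along h q] witnesses that [p] is Rudin-Keisler below
    [q]. *)
Definition limit_along (h : site -> site) (p : set_system site) :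
  set_system site := [set A | p (h @^-1` A)].

Theorem inequivalent_ultrafilters :
  exists P : (continuum -> bool) -> set_system site,
  [/\ forall f, free_ultrafilter (P f), forall f, weakly_P (P f) &
      forall f g h h', P f = limit_along h (P g) ->
        P g = limit_along h' (P f) -> f = g].
Proof.
have /choice[u uP] := linked_ultrafilter.
have u_inj f g : u f = u g -> f = g.
  move=> ufg; apply/funext => z.
  have [pf _ _ /(_ z) mf _] := uP f; have [_ _ _ /(_ z) mg _] := uP g.
  by rewrite -ufg in mg; have [x [<- <-]] := filter_ex (filterI mf mg).
pose le f g := exists h, u f = limit_along h (u g).
have le_refl f : le f f by exists id.
have le_trans f g k : le f g -> le g k -> le f k.
  by move=> [h fg] [h' gk]; exists (h \o h'); rewrite fg gk.
pose eqv f g := le f g /\ le g f.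
pose rep f := xget (fun=> false) [set g | eqv f g].
have repP f : eqv f (rep f).
  by apply: (xgetPex _ (ex_intro (eqv f) f _)).
have rep_eq f g : eqv f g -> rep f = rep g.
  move=> [fg gf]; rewrite /rep (_ : [set k | eqv f k] = [set k | eqv g k]) //.
  apply/seteqP; split => k [? ?]; split.
  - exact: le_trans gf _.
  - exact: le_trans fg.
  - exact: le_trans fg _.
  - exact: le_trans gf.
(* Koenig's argument: [f] codes a family indexed by the maps [h], and the
   class of [f] together with some [h] determines [f]. *)
have [c c_inj] : exists c : (site -> site) * continuum -> continuum,
    injective c.
  have [c cinj] := continuum_code (site * site + nat)%type.
  exists (fun hz => c (fun i => match i with
    inl xy => hz.1 xy.1 == xy.2 | inr n => hz.2 n end)).
  move=> [h z] [h' z'] /cinj e; congr (_, _); apply/funext => x.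
    have := congr1 (fun k => k (inl (x, h x))) e.
    by rewrite /= eqxx => /esym/eqP.
  exact: (congr1 (fun k => k (inr x)) e).
pose D f h : continuum -> bool := fun z => f (c (h, z)).
have [h hsurj] : exists h, forall y, exists g,
    rep g = g /\ exists2 f, u f = limit_along h (u g) & D f h = y.
  apply: contrapT => nh.
  (* If every [h] missed a value [Y h], the [f] coding the family [Y] would not lie below its own
     representative through any [h]. *)
  have /choice[Y YP] : forall h, exists y, forall g, rep g = g ->
      forall f, u f = limit_along h (u g) -> D f h <> y.
    move=> h; apply: contrapT => ny; apply: nh; exists h => y.
    apply: contrapT => ng; apply: ny; exists y => g rg f fg fy; apply: ng.
    by exists g; split => //; exists f.
  pose f w := `[< exists h z, c (h, z) = w /\ Y h z >].
  have DY h : D f h = Y h.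
    apply/funext => z; apply/asboolP/idP => [[h' [z' [/c_inj[-> ->]]]]//|hz].
    by exists h, z.
  have [[h fh] _] := repP f.
  by apply: (YP h (rep f) _ f fh (DY h)); apply/esym/rep_eq/repP.
have /choice[G GP] := hsurj.
(* The index [y] is recovered from [u (G y)]: its image under [h] is [u f] for a single [f], and
   [y = D f h]. *)
exists (fun y => u (G y)); split => [f|f|f g k k' fg gf].
- have [pf ult lev _ _] := uP (G f); split => // A Afin pA.
  suff [k Ak] : exists k, forall x, A x -> (level x < k)%N.
    have [x [/Ak xk]] := filter_ex (filterI pA (lev k)).
    by rewrite /= leqNgt xk.
  move/finite_seqP : Afin => [s ->].
  elim: s => [|x s [k sk]]; first by exists 0%N.
  exists (maxn (level x).+1 k) => y /=.
  rewrite inE leq_max => /orP[/eqP ->|/sk ->].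
    by rewrite ltnSn.
  by rewrite orbT.
- by apply: linked_weakly_P; have [] := uP (G f).
- have GG : G f = G g.
    by rewrite -(GP f).1 -(GP g).1; apply: rep_eq; split; [exists k|exists k'].
  have [_ [f' uf <-]] := GP f; have [_ [g' ug <-]] := GP g.
  by rewrite (u_inj f' g') // uf ug GG.
Qed.

(** * Separation of countably many copies *)

Definition push (T U : Type) (a : T -> U) (p : set_system T) : set_system U :=
  [set B | p (a @^-1` B)].

Lemma push_free (T U : Type) (a : T -> U) (p : set_system T) :
  injective a -> free_ultrafilter p -> free_ultrafilter (push a p).
Proof.
move=> ainj [pF pU pfin]; split; first exact: fmap_proper_filter.
  by move=> A; exact: pU.
move=> A Afin; apply: pfin; apply: finite_preimage Afin.
by move=> x y _ _; exact: ainj.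
Qed.

Lemma ultrafilter_sub_eq (T : Type) (p q : set_system T) :
  free_ultrafilter p -> free_ultrafilter q -> p `<=` q -> p = q.
Proof.
move=> [pF pU _] [qF _ _] pq; apply/seteqP; split => // A qA.
have [//|/pq qA'] := pU A.
by have [x []] := filter_ex (filterI qA qA').
Qed.

(** The map is the inverse of [a] after [b], defined on a set of [q], with a default value
    elsewhere. *)
Lemma push_limit_along (T : Type) (a b : site -> T) (p q : set_system site) :
  injective a -> free_ultrafilter p -> free_ultrafilter q ->
  push a p = push b q -> exists h, p = limit_along h q.
Proof.
move=> ainj pU qU pq.
have [pF _ _] := pU; have [qF _ _] := qU.
have [x0 _] := filter_ex (@filterT _ p _).
pose h y := xget x0 [set x | a x = b y].
have hq : forall A, p A -> q (h @^-1` A).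
  move=> A pA; have qA : push b q (a @` A).
    rewrite -pq /push /=; apply: filterS pA => x Ax; by exists x.
  apply: filterS (qA : q (b @^-1` _)) => y [x Ax axy]; rewrite /preimage /=.
  have : a (h y) = b y.
    exact: (xgetPex _ (ex_intro (fun x => a x = b y) x axy)).
  by rewrite -axy => /ainj ->.
exists h; apply/seteqP; split; first exact: hq.
move=> A qA; have [_ pcase _] := pU; have [//|/hq qA'] := pcase A.
by have [x []] := filter_ex (filterI qA qA').
Qed.

Section Separation.
Variables (I T : Type) (a : I -> site -> T) (P : I -> set_system site).
Hypothesis ainj : forall i, injective (a i).
Hypothesis PU : forall i, free_ultrafilter (P i).
Hypothesis PwP : forall i, weakly_P (P i).
Hypothesis Pinequiv : forall i j h h', P i = limit_along h (P j) ->
  P j = limit_along h' (P i) -> i = j.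

Let Q i := push (a i) (P i).

Let QU i : free_ultrafilter (Q i).
Proof. exact: push_free. Qed.

(** The weak P-property is applied to the traces of the other ultrafilters on the range of [a i].
    Copies with different indices differ, since equal ones would have Rudin-Keisler equivalent
    originals. *)
Lemma push_separated i (g : nat -> I) :
  exists2 V, Q i V & forall n, g n <> i -> ~ Q (g n) V.
Proof.
have image_inter A B : a i @` (A `&` B) = (a i @` A) `&` (a i @` B).
  apply/seteqP; split => [_ [x [Ax Bx] <-]|_ [[x Ax <-] [y By /ainj yx]]].
    by split; exists x.
  by exists x => //; split => //; rewrite -yx.
(* The clause [g n <> i] empties the family wherever [g] takes the value [i]. *)
have [||||V PV nV] :=
    PwP (q := fun n => [set A | g n <> i /\ Q (g n) (a i @` A)]) (i := i).
- move=> n A B [gi QA] [_ QB]; split => //; rewrite image_inter.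
  by have [? _ _] := QU (g n); exact: filterI.
- move=> n A B AB [gi QA]; split => //; have [? _ _] := QU (g n).
  by apply: filterS QA; exact: image_subset.
- move=> n A B Bfin [gi QA]; split => //; have [F Ucase fin] := QU (g n).
  have [QB|QB] := Ucase (a i @` B).
    by case: (fin _ (finite_image (a i) Bfin) QB).
  apply: filterS (filterI QA QB) => _ [[x Ax <-] nBx].
  by exists x => //; split => // Bx; apply: nBx; exists x.
- move=> n; have [gi|ngi] := pselect (g n = i).
    by exists setT; [have [F _ _] := PU i; exact: filterT|case].
  have [U QiU nQU] : exists2 U, Q i U & ~ Q (g n) U.
    apply: contrapT => nU; apply: ngi.
    have QE : Q i = Q (g n).
      apply: ultrafilter_sub_eq => // U QiU; apply: contrapT => nQU.
      by apply: nU; exists U.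
    have [h ih] := push_limit_along (@ainj i) (PU i) (PU (g n)) QE.
    have [h' ih'] := push_limit_along (@ainj (g n)) (PU (g n)) (PU i) (esym QE).
    exact/esym/(Pinequiv ih ih').
  exists (a i @^-1` U) => // -[_ QU']; apply: nQU.
  by have [F _ _] := QU (g n); apply: filterS QU' => _ [x Ux <-].
exists (a i @` V).
  have [F _ _] := PU i; rewrite /Q /push /=.
  by apply: filterS PV => x Vx; exists x.
by move=> n gi QV; exact: (nV n).
Qed.

(** From each [V i] the finitely many sets of earlier indices are removed; their complements lie in
    the ultrafilter. As [g] may repeat, [N i] fixes one index for each value. *)
Lemma push_disjoint (g : nat -> I) : exists D : I -> set T,
  (forall n, Q (g n) (D (g n))) /\
  forall n m y, D (g n) y -> D (g m) y -> g n = g m.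
Proof.
have /choice[V VP] : forall i, exists V,
    Q i V /\ forall n, g n <> i -> ~ Q (g n) V.
  by move=> i; have [V QV nV] := push_separated i g; exists V.
pose N i := xget 0%N [set n | g n = i].
have NK n : g (N (g n)) = g n.
  exact: (xgetPex _ (ex_intro (fun m => g m = g n) n erefl)).
exists (fun i => [set y | V i y /\
  forall m, (m < N i)%N -> g m <> i -> ~ V (g m) y]).
split=> [n|n m y [Vn nn] [Vm nm]].
  have [F Ucase _] := QU (g n).
  have QN : Q (g n) [set y | forall m, (m < N (g n))%N ->
      g m <> g n -> ~ V (g m) y].
    elim: (N (g n)) => [|k IH]; first by apply: filterS filterT => y _ m.
    have [gk|gk] := pselect (g k = g n).
      apply: filterS IH => y yk m; rewrite ltnS leq_eqVlt => /orP[/eqP -> //|].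
      exact: yk.
    have QVk : Q (g n) (~` V (g k)).
      by have [|//] := Ucase (V (g k)); move/((VP (g k)).2 n (nesym gk)).
    apply: filterS (filterI IH QVk) => y [yk nVk] m.
    by rewrite ltnS leq_eqVlt => /orP[/eqP -> //|]; exact: yk.
  exact: filterS (filterI (VP (g n)).1 QN).
have [//|gnm] := pselect (g n = g m).
have [lt_nm|lt_mn|eq_nm] := ltngtP (N (g n)) (N (g m)).
- by case: (nm _ lt_nm); rewrite NK.
- by case: (nn _ lt_mn); rewrite NK // => /esym.
- by rewrite -(NK n) -(NK m) eq_nm.
Qed.

End Separation.

(** * The space *)

Section Space.
Variables (K : Type) (S : countType).
Variables (a : K * bool -> S -> K) (Q : K * bool -> set_system K).
Hypothesis Kinf : infinite_set [set: K].
Hypothesis QU : forall i, free_ultrafilter (Q i).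
Hypothesis Qa : forall i, Q i (range (a i)).
Hypothesis Qdisj : forall g : nat -> K * bool, exists D : K * bool -> set K,
  (forall n, Q (g n) (D (g n))) /\
  forall n m y, D (g n) y -> D (g m) y -> g n = g m.
Hypothesis Qpairs : forall A B : set K, infinite_set A -> infinite_set B ->
  exists x, Q (x, true) A /\ Q (x, false) B.

(* Every [x] is a limit of the two ultrafilters [Q (x, true)] and
   [Q (x, false)]. *)
Definition limit_open : set_system K :=
  [set U | forall x b, U x -> Q (x, b) U].

Lemma limit_openT : limit_open setT.
Proof. by move=> x b _; have [F _ _] := QU (x, b); exact: filterT. Qed.

Lemma limit_openI : setI_closed limit_open.
Proof.
move=> A B oA oB x b [Ax Bx]; have [F _ _] := QU (x, b).
by apply: filterI; [exact: oA|exact: oB].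
Qed.

Lemma limit_open_bigU (I : Type) (f : I -> set K) :
  (forall i, limit_open (f i)) -> limit_open (\bigcup_i f i).
Proof.
move=> fo x b [i _ fix_]; have [F _ _] := QU (x, b).
by apply: filterS (fo i x b fix_) => y fy; exists i.
Qed.

(** Each step enters the range of one of the two maps of the current point. These ranges lie in the
    ultrafilters and the words are countably many, so the points reached form a countable open
    set. *)
Definition walk (x : K) (w : seq (S * bool)) : K :=
  foldl (fun y sb => a (y, sb.2) sb.1) x w.

Lemma limit_open_walk x : limit_open (range (walk x)).
Proof.
move=> _ b [w _ <-]; have [F _ _] := QU (walk x w, b).
apply: filterS (Qa (walk x w, b)) => _ [s _ <-].
by exists (rcons w (s, b)) => //; rewrite /walk foldl_rcons.
Qed.

Inductive reach (E : K * bool -> set K) (x : K) : K -> Prop :=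
| reach_refl : reach E x x
| reach_step y b z : reach E x y -> E (y, b) z -> reach E x z.

Lemma reach_inv E x z : reach E x z ->
  z = x \/ exists u b, reach E x u /\ E (u, b) z.
Proof. by case=> [|u b t xu Et]; [left|right; exists u, b]. Qed.

(* The sets [E] give every point at most one parent and the roots none, so the
   trees below the two roots are disjoint. *)
Lemma limit_open_separated (x y : K) : x <> y -> exists U V,
  [/\ limit_open U, limit_open V, U x, V y & U `&` V = set0].
Proof.
move=> xy.
pose root (c : bool) := if c then x else y.
pose G : set K := [set z | exists c w, walk (root c) w = z].
have oG : limit_open G.
  move=> z b [c [w <-]]; have [F _ _] := QU (walk (root c) w, b).
  apply: filterS (@limit_open_walk (root c) (walk (root c) w) b _).
    by move=> _ [w' _ <-]; exists c, w'.
  by exists w.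
(* An enumeration of all ultrafilters at points of the countable set [G]. *)
pose g (n : nat) : K * bool :=
  if unpickle n is Some (c, w, b) then (walk (root c) w, b) else (x, true).
have gG z b : G z -> exists n, g n = (z, b).
  by move=> [c [w <-]]; exists (pickle (c, w, b)); rewrite /g pickleK.
have [D [QD Ddisj]] := Qdisj g.
(* Meeting with [G] keeps the trees where [D] is disjoint; removing the two roots leaves them
   without a parent. *)
pose E i := D i `&` G `&` ~` [set x; y].
have QE z b : G z -> Q (z, b) (E (z, b)).
  move=> Gz; have [F Ucase fin] := QU (z, b).
  apply: filterI; first apply: filterI.
  - by have [n <-] := gG z b Gz; exact: QD.
  - exact: oG.
  - by have [/fin []|//] := Ucase [set x; y]; rewrite finite_setU; split.
have reachG c z : reach E (root c) z -> G z.
  by case=> [|z' b t _ [[_ Gt] _]] //; exists c, [::].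
have oreach c : limit_open (reach E (root c)).
  move=> z b rz; have [F _ _] := QU (z, b).
  apply: filterS (QE z b (reachG _ _ rz)) => t Et; exact: reach_step Et.
exists (reach E (root true)), (reach E (root false)).
split; [exact: (oreach true)|exact: (oreach false)|exact: reach_refl
       |exact: reach_refl|].
rewrite -subset0 => z [rx ry].
(* Going back along the two paths: a root has no parent, and two parents of one point coincide. *)
elim: rx ry => [|u b t ru IH Et] /reach_inv[zy|[u' [b' [ru' Et']]]].
- exact: xy.
- by apply: Et'.2; left.
- by apply: Et.2; right.
have [n gn] := gG u b (reachG true _ ru).
have [m gm] := gG u' b' (reachG false _ ru').
have := Ddisj n m t; rewrite gn gm => /(_ Et.1.1 Et'.1.1)[uu' _].
by apply: IH; rewrite uu'.
Qed.

Lemma limit_space : exists X : topologicalType,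
  [/\ locally_countable X, strongly_anti_Urysohn X & [set: X] #= [set: K]].
Proof.
pose X : topologicalType := HB.pack {classic K}
  (isOpenTopological.Build {classic K} limit_openT limit_openI limit_open_bigU).
have oX (U : set X) : limit_open U -> open U.
  by [].
have nX (x : X) (U : set X) : nbhs x U ->
    exists2 V, limit_open V & V x /\ V `<=` U.
  by rewrite nbhsE => -[V [oV Vx] VU]; exists V.
(* An open singleton would belong to a free ultrafilter. *)
have ninj (x : X) : ~ isolated [set: X] x.
  move=> [_ [V /nX[W oW [Wx WV]] VE]]; have [F _ fin] := QU (x, true).
  apply: (fin [set x]) => //; apply: filterS (oW x true Wx) => y /WV Vy.
  by rewrite -VE.
exists X; split; last exact: card_eqxx.
- move=> x; exists (range (walk x)).
    by apply: open_nbhs_nbhs; split; [exact/oX/limit_open_walk|exists [::]].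
  by apply: card_le_trans (card_image_le _ _) _; exact: countableP.
- split.
  + move=> x y xy; apply: contrapT => nxy.
    have [U [V [oU oV Ux Vy UV]]] := limit_open_separated nxy.
    have [z] := xy U V (open_nbhs_nbhs (conj (oX U oU) Ux))
                       (open_nbhs_nbhs (conj (oX V oV) Vy)).
    by rewrite UV.
  + have [x _] := infinite_setN0 Kinf.
    have /infinite_setN0[y [_ /= nyx]] : infinite_set ([set: K] `\` [set x]).
      exact: infinite_setD.
    by exists y, x; split.
  + have clX (C : set X) x b : closed C -> Q (x, b) C -> C x.
      move=> Ccl QC; apply: Ccl => U /nX[W oW [Wx WU]].
      have [F _ _] := QU (x, b).
      by have [z [Cz /WU]] := filter_ex (filterI QC (oW x b Wx)); exists z.
    move=> A B Acl Ainf Bcl Binf; have [x [QA QB]] := Qpairs Ainf Binf.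
    by exists x; split; [exact: clX QA|exact: clX QB].
Qed.

End Space.

(** * Codings of points and of pairs of infinite sets *)

Lemma card_le_injection (T U : Type) (A : set U) : [set: T] #<= A ->
  exists f : T -> U, injective f /\ forall x, A (f x).
Proof.
move=> /card_leP[f].
exists (fun x => val (f (SigSub (mem_setT x)))); split => [x y|x].
  move=> /val_inj/(@inj _ _ _ f) h.
  by have := h (mem_setT _) (mem_setT _); case.
exact/set_mem/(valP (f _)).
Qed.

Lemma infinite_injective_seq (T : Type) (A : set T) : infinite_set A ->
  exists s : nat -> T, injective s /\ forall n, A (s n).
Proof. by move=> /infiniteP/card_le_injection. Qed.

(** Each point needs two ultrafilters. The first digit of [c] selects whether the point, evaluated
    at the remaining digits, or the bit is read. *)
Lemma double_code (K : Type) : [set: K] #<= [set: continuum -> bool] ->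
  exists j : K * bool -> continuum -> bool, injective j.
Proof.
move=> /card_le_injection[i [i_inj _]].
exists (fun xb c => if c 0 then i xb.1 (c \o S) else xb.2) => -[x b] [y d] e.
have /= -> := congr1 (fun h => h (fun=> false)) e.
congr (_, _); apply: i_inj; apply/funext => c.
exact: (congr1 (fun h => h (fun n => if n is m.+1 then c m else true)) e).
Qed.

(** Points enumerate the sequences in [K]: the odd terms serve [(x, true)], the even ones
    [(x, false)]. A branch that is not injective is replaced by a fixed injective sequence. *)
Lemma enumeration_of_pairs (K : Type) : infinite_set [set: K] ->
  [set: K] #= [set: nat -> K] ->
  exists a : K * bool -> site -> K, (forall i, injective (a i)) /\
    forall A B, infinite_set A -> infinite_set B -> exists x,
      (forall s, A (a (x, true) s)) /\ (forall s, B (a (x, false) s)).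
Proof.
move=> Kinf KE.
have [s0 [s0_inj _]] := infinite_injective_seq Kinf.
have [e esurj] : exists e : K -> nat -> K, forall t, exists x, e x = t.
  move: KE; rewrite card_eq_le => /andP[_ /pfcard_geP[K0|[e]]].
    by have : [set: nat -> K] (fun=> s0 0) by []; rewrite K0.
  by exists e => t; have [x _ <-] := @surj _ _ _ _ e t I; exists x.
have pickle_inj : injective (@pickle site) by exact: pcan_inj pickleK.
pose branch (i : K * bool) n := e i.1 (i.2 + n.*2).
exists (fun i s => if `[< injective (branch i) >] then branch i (pickle s)
                   else s0 (pickle s)); split.
  move=> i s t; case: asboolP => [h /h/pickle_inj//|_ /s0_inj/pickle_inj//].
move=> A B Ainf Binf.
have [sA [sA_inj sAA]] := infinite_injective_seq Ainf.
have [sB [sB_inj sBB]] := infinite_injective_seq Binf.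
have [x xE] := esurj (fun n => if odd n then sA n./2 else sB n./2).
have bA : branch (x, true) = sA.
  by apply/funext => n; rewrite /branch xE oddD oddb odd_double half_bit_double.
have bB : branch (x, false) = sB.
  by apply/funext => n; rewrite /branch xE oddD oddb odd_double half_bit_double.
exists x; split => s.
  by rewrite bA; case: asboolP.
by rewrite bB; case: asboolP.
Qed.

Theorem theorem2p7 (K : Type)
  (K_infinite : infinite_set [set: K])
  (K_power_omega : [set: K] #= [set: nat -> K])
  (K_le_2c : [set: K] #<= [set: continuum -> bool]) :
  exists X : topologicalType,
    [/\ locally_countable X, strongly_anti_Urysohn X & [set: X] #= [set: K]].
Proof.
have [P [PU PwP Pineq]] := inequivalent_ultrafilters.
have [j j_inj] := double_code K_le_2c.
have [a [a_inj pairs]] := enumeration_of_pairs K_infinite K_power_omega.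
apply: (@limit_space K site a (fun i => push (a i) (P (j i)))) => //.
- by move=> i; exact: push_free.
- move=> i; have [F _ _] := PU (j i); rewrite /push /=.
  by apply: filterS filterT => s _; exists s.
- move=> g.
  apply: (push_disjoint a_inj (fun i => PU (j i)) (fun i => PwP (j i))).
  by move=> i i' h h' e e'; exact/j_inj/(Pineq _ _ _ _ e e').
- move=> A B Ainf Binf; have [x [xA xB]] := pairs A B Ainf Binf.
  exists x; split; rewrite /push /=.
    have [F _ _] := PU (j (x, true)).
    by apply: filterS filterT => s _; exact: xA.
  have [F _ _] := PU (j (x, false)).
  by apply: filterS filterT => s _; exact: xB.
Qed.
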